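(* Let $a$ be a positive integer, $R = \mathbb{Z}[x,y,z]/(x^{2a},y^{2a},z^{2a})$ graded by total degree, and $m=3a-2$. Let $C_3=\{1,\rho,\rho^2\}$ act on $R$ by the ring automorphism $\rho$ cycling the variables $x\mapsto y\mapsto z\mapsto x$, and let $R^{C_3}$ be the invariant subring, with homogeneous components $R^{C_3}_r$ (free $\mathbb{Z}$-modules). Multiplication by $x+y+z$ maps $R^{C_3}_m$ into $R^{C_3}_{m+1}$; call this restricted map $U_m|_{R^{C_3}}$. Then $\det(U_m|_{R^{C_3}})$ (computed with respect to any $\mathbb{Z}$-bases, hence defined up to sign) equals, up to sign, the number of cyclically symmetric plane partitions in an $a\times a\times a$ box.
   Context: A plane partition fitting in an $a\times a\times a$ box is an array $(\pi_{i,j})_{1\le i,j\le a}$ of integers in $\{0,\ldots,a\}$ weakly decreasing along rows and columns; equivalently the set $S_\pi=\{(i,j,k)\in\{1,\ldots,a\}^3 : k\le \pi_{i,j}\}$. It is cyclically symmetric if $S_\pi$ is invariant under $(i,j,k)\mapsto(j,k,i)$. A $\mathbb{Z}$-basis of $R^{C_3}_r$ is given by the orbit sums $x^iy^jz^k+y^iz^jx^k+z^ix^jy^k$, and $R^{C_3}_m$, $R^{C_3}_{m+1}$ have the same rank. *)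

(* Defs.v *)
From mathcomp Require Import all_boot all_order all_algebra.
Set Implicit Arguments. Unset Strict Implicit. Unset Printing Implicit Defensive.
Import GRing.Theory Num.Theory.
Local Open Scope ring_scope.

(* Exponent triples (i,j,k), 0 <= i,j,k < 2a: the monomials x^i y^j z^k
   forming the Z-basis of R = Z[x,y,z]/(x^(2a),y^(2a),z^(2a)). *)
Definition expo (a : nat) := ('I_(2 * a) * 'I_(2 * a) * 'I_(2 * a))%type.

(* Elements of R: integer coefficient vectors on the monomial basis. *)
Definition Relt (a : nat) := {ffun expo a -> int}.

Definition e1 a (t : expo a) : nat := t.1.1.
Definition e2 a (t : expo a) : nat := t.1.2.
Definition e3 a (t : expo a) : nat := t.2.

Definition deg a (t : expo a) : nat := (e1 t + e2 t + e3 t)%N.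

(* multiplication in R (truncated: monomials with an exponent >= 2a vanish) *)
Definition Rmul a (f g : Relt a) : Relt a :=
  [ffun t => \sum_(s : expo a) \sum_(u : expo a |
      [&& (e1 s + e1 u == e1 t)%N, (e2 s + e2 u == e2 t)%N
        & (e3 s + e3 u == e3 t)%N]) f s * g u].

Definition xyz a : Relt a :=
  [ffun t => if deg t == 1%N then 1 else 0].

Definition U a (f : Relt a) : Relt a := Rmul f (xyz a).

(* rho : x -> y -> z -> x sends x^i y^j z^k to y^i z^j x^k = x^k y^i z^j,
   i.e. acts on exponents by (i,j,k) |-> (k,i,j). *)
Definition rotE a (t : expo a) : expo a := (t.2, t.1.1, t.1.2).

Definition orbitE a (t : expo a) : {set expo a} :=
  [set t; rotE t; rotE (rotE t)].
Definition osum a (t : expo a) : Relt a :=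
  [ffun s => if s \in orbitE t then 1 else 0].

Definition code a (t : expo a) : nat :=
  (e1 t * (2 * a) * (2 * a) + e2 t * (2 * a) + e3 t)%N.
Definition isrep a (t : expo a) : bool :=
  (code t <= code (rotE t))%N && (code t <= code (rotE (rotE t)))%N.

(* index set of the orbit-sum Z-basis of R^{C_3}_r *)
Definition basisC3 a (r : nat) : {set expo a} :=
  [set t | (deg t == r) && isrep t].

(* Matrix of U_m restricted to R^{C_3}_m -> R^{C_3}_{m+1} in the orbit-sum
   bases: entry (b, c) is the coordinate on the basis vector osum c of
   U (osum b); as every monomial of an orbit has coefficient 1 in its orbit
   sum, this coordinate is the coefficient of the monomial c. *)
Definition Umat a (m : nat) : 'M[int]_(#|basisC3 a m|, #|basisC3 a m.+1|) :=
  \matrix_(b, c) (U (osum (enum_val b))) (enum_val c).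

Definition is_pp a (p : {ffun 'I_a * 'I_a -> 'I_a.+1}) : bool :=
  [forall i : 'I_a, forall j : 'I_a, forall i' : 'I_a, forall j' : 'I_a,
     ((i <= i')%N && (j <= j')%N) ==> (p (i', j') <= p (i, j))%N].

Definition Spp a (p : {ffun 'I_a * 'I_a -> 'I_a.+1}) : {set 'I_a * 'I_a * 'I_a} :=
  [set t : 'I_a * 'I_a * 'I_a | (t.2 < p (t.1.1, t.1.2))%N].

Definition is_cs a (p : {ffun 'I_a * 'I_a -> 'I_a.+1}) : bool :=
  [forall t : 'I_a * 'I_a * 'I_a,
     (t \in Spp p) == ((t.1.2, t.2, t.1.1) \in Spp p)].

Definition ncspp (a : nat) : nat :=
  #|[set p : {ffun 'I_a * 'I_a -> 'I_a.+1} | is_pp p && is_cs p]|.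

(* Main.v *)
Require Import Defs.
From mathcomp Require Import all_boot all_order all_algebra.
From mathcomp Require Import fingroup perm zify.
Import Defs.
Import GRing.Theory Num.Theory.
Local Open Scope ring_scope.

(* Monomials of degree [3a - 2] and [3a - 1] are the up- and down-triangles of a
   triangulated hexagon of side [a], and multiplication by [x + y + z] is the adjacency
   of triangles. Hence the determinant on orbit sums is a signed sum over the rotation
   invariant perfect matchings of triangles, i.e. rotation invariant lozenge tilings.
   Lifting a tiling to the stepped surface of a pile of cubes gives a height function,
   and these are in bijection with cyclically symmetric plane partitions.  Removing the
   rotation orbit of a cube with maximal coordinate sum multiplies the permutation of
   the orbits by one of order dividing 3, which is even; so all the terms have the sign
   of the empty partition. *)

Set Implicit Arguments. Unset Strict Implicit. Unset Printing Implicit Defensive.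

(** * Height functions *)

Local Open Scope nat_scope.

(** Matrix entries can exceed 1: the exponents [(a-1, a, a-1)] and [(a, a-1, a-1)] lie in one orbit
    and both divide [(a, a, a-1)]. A Leibniz term over orbits therefore does not name a tiling. The
    determinant is expanded over actual divisors of the column representatives, and such a choice
    spreads unambiguously by rotation because 3 divides neither 3a-2 nor 3a-1, so that no monomial
    involved is fixed by [rotE]. The vertices of the hexagon are the triples of sum 3a with entries
    in [0, 2a]; a point (p, q, r) of the box projects along (1, 1, 1) to (a+q-r, a+r-p, a+p-q). An
    edge of the triangulation lifts either to a unit segment or to a diagonal of a unit square. Each
    triangle has exactly one diagonal edge, and gluing triangles along these edges gives the
    lozenges. One coordinate of the surface determines the other two, so the geometry reduces to
    linear inequalities on [G]. *)

Definition hex (a x y : nat) : bool :=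
  [&& x <= 2 * a, y <= 2 * a, a <= x + y & x + y <= 3 * a].

(* [G x y] is the third coordinate of the point of the stepped surface that lies
   over the vertex [(x, y, 3a - x - y)]; the other two coordinates of that point
   are [G x y + a - y] and [G x y + x - a]. *)
Record height (a : nat) (G : nat -> nat -> nat) : Prop := Height {
  height_bounds : forall x y, hex a x y ->
    [/\ y <= G x y + a, a <= G x y + x, G x y <= a, G x y <= y
      & G x y + x <= 2 * a];
  height_stepy : forall x y, hex a x y -> hex a x y.+1 ->
    G x y <= G x y.+1 <= (G x y).+1;
  height_stepx : forall x y, hex a x y -> hex a x.+1 y ->
    G x.+1 y <= G x y <= (G x.+1 y).+1;
  height_stepxy : forall x y, hex a x.+1 y -> hex a x y.+1 ->
    G x.+1 y <= G x y.+1 <= (G x.+1 y).+1;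
  height_rot : forall x y z, hex a x y -> x + y + z = 3 * a ->
    G z x + a = G x y + x }.

Record cyclic_ideal (a : nat) (S : nat -> nat -> nat -> bool) : Prop := CyclicIdeal {
  ideal_box : forall i j k, S i j k -> [/\ i < a, j < a & k < a];
  ideal_down : forall i j k i' j' k', i <= i' -> j <= j' -> k <= k' ->
    S i' j' k' -> S i j k;
  ideal_rot : forall i j k, S i j k = S j k i }.

(** The cell tested has its lowest corner on the line of direction (1, 1, 1) over the vertex. The
    two inequalities say that this corner has nonnegative coordinates, which keeps the truncated
    subtractions exact. *)
Definition above a (S : nat -> nat -> nat -> bool) x y k : bool :=
  [&& y <= k + a, a <= x + k & ~~ S (k + a - y) (x + k - a) k].

Definition surface a S x y : nat := find (above a S x y) (iota 0 a.+1).

(** * The surface of a cyclically symmetric pile *)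

Section Surface.
Variables (a : nat) (S : nat -> nat -> nat -> bool).
Hypothesis idS : cyclic_ideal a S.

Lemma above_a x y : hex a x y -> above a S x y a.
Proof.
rewrite /hex /above => h; case E: (S _ _ _); last by lia.
by have [] := ideal_box idS E; lia.
Qed.

Lemma surface_le x y k : hex a x y -> above a S x y k -> surface a S x y <= k.
Proof.
move=> h hk; rewrite leqNgt; apply/negP => hlt.
have hs : has (above a S x y) (iota 0 a.+1).
  by apply/hasP; exists a; rewrite ?mem_iota ?above_a //; lia.
have hka : k < a.+1.
  by move: hs; rewrite has_find size_iota -/(surface a S x y); lia.
have := before_find 0 hlt.
by rewrite nth_iota // add0n hk.
Qed.

Lemma surface_above x y : hex a x y -> above a S x y (surface a S x y).
Proof.
move=> h.
have hs : has (above a S x y) (iota 0 a.+1).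
  by apply/hasP; exists a; rewrite ?mem_iota ?above_a //; lia.
have := nth_find 0 hs.
by rewrite nth_iota ?add0n // -[X in _ < X](size_iota 0) -has_find.
Qed.

(** Increasing coordinates never enters a down-closed pile; every step inequality of the surface is
    an instance of this. *)
Lemma above_down x y k x' y' k' : above a S x y k ->
  y' <= k' + a -> a <= x' + k' ->
  k + a - y <= k' + a - y' -> x + k - a <= x' + k' - a -> k <= k' ->
  above a S x' y' k'.
Proof.
rewrite /above => /and3P[h1 h2 h3] -> -> l1 l2 l3 /=.
by apply: contra h3; apply: (ideal_down idS).
Qed.

Lemma above_rot x y z k k' : hex a x y -> x + y + z = 3 * a ->
  k' + a = k + x -> above a S z x k' = above a S x y k.
Proof.
rewrite /hex /above => h e e'.
have -> : S (k + a - y) (x + k - a) k = S k (k + a - y) (x + k - a).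
  by rewrite (ideal_rot idS) (ideal_rot idS).
have -> : k' + a - x = k by lia.
have -> : x + k - a = k' by lia.
have -> : z + k' - a = k + a - y by lia.
by case: (S _ _ _); lia.
Qed.

Lemma surface_height : height a (surface a S).
Proof.
have L := surface_le; have A := surface_above.
split.
- move=> x y h; have := A _ _ h; rewrite {1}/above => /and3P[h1 h2 h3].
  split; [lia | lia | by apply: L => //; apply: above_a | | ].
  + apply: L => //; rewrite /above; move: (h); rewrite /hex => h'.
    case E: (S _ _ _); last by lia.
    by have [] := ideal_box idS E; lia.
  + suff: surface a S x y <= 2 * a - x by move: h; rewrite /hex; lia.
    apply: L => //; rewrite /above; move: (h); rewrite /hex => h'.
    case E: (S _ _ _); last by lia.
    by have [] := ideal_box idS E; lia.
- move=> x y h h'; apply/andP; split; apply: L => //.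
  + by have := A _ _ h' => B; apply: (above_down B); move: B; rewrite /above; lia.
  + by have := A _ _ h => B; apply: (above_down B); move: B; rewrite /above; lia.
- move=> x y h h'; apply/andP; split; apply: L => //.
  + by have := A _ _ h => B; apply: (above_down B); move: B; rewrite /above; lia.
  + by have := A _ _ h' => B; apply: (above_down B); move: B; rewrite /above; lia.
- move=> x y h h'; apply/andP; split; apply: L => //.
  + by have := A _ _ h' => B; apply: (above_down B); move: B; rewrite /above; lia.
  + by have := A _ _ h => B; apply: (above_down B); move: B; rewrite /above; lia.
- move=> x y z h e.
  have h' : hex a z x by move: h; rewrite /hex; lia.
  have B := A _ _ h; have B' := A _ _ h'.
  have C : surface a S z x <= surface a S x y + x - a.
    by apply: L => //; rewrite (above_rot (k := surface a S x y) h e) //;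
       move: B; rewrite /above; lia.
  have C' : surface a S x y <= surface a S z x + a - x.
    by apply: L => //; rewrite -(above_rot (k' := surface a S z x) h e) //;
       move: B'; rewrite /above; lia.
  by move: B B'; rewrite /above; lia.
Qed.

(** The cell [(i, j, k)] lies on the line over [(a + j - k, a + k - i)], and by down-closure the
    cells of [S] on that line are those below the surface. Hence the surface determines [S]. *)
Lemma surface_mem i j k : S i j k =
  [&& i < a, j < a, k < a & k < surface a S (a + j - k) (a + k - i)].
Proof.
apply/idP/and4P.
- move=> Sijk; have [hi hj hk] := ideal_box idS Sijk; split=> //.
  have h : hex a (a + j - k) (a + k - i) by rewrite /hex; lia.
  rewrite ltnNge; apply/negP => le.
  have := above_down (x' := a + j - k) (y' := a + k - i) (k' := k) (surface_above h).
  rewrite /above => /(_ _ _ _ _ le)/and3P[]; try by lia.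
  have -> : k + a - (a + k - i) = i by lia.
  have -> : (a + j - k) + k - a = j by lia.
  by move=> _ _ /negP; apply.
- case=> hi hj hk; apply: contraLR => nS; rewrite -leqNgt.
  apply: surface_le; rewrite /hex /above; first by lia.
  rewrite (_ : k + a - (a + k - i) = i); last by lia.
  rewrite (_ : (a + j - k) + k - a = j); last by lia.
  by rewrite nS; lia.
Qed.

Lemma surface_unique G : height a G ->
  (forall i j k, i < a -> j < a -> k < a ->
     S i j k = (k < G (a + j - k) (a + k - i))) ->
  forall x y, hex a x y -> surface a S x y = G x y.
Proof.
move=> hG SG x y h; have [b1 b2 b3 b4 b5] := height_bounds hG h.
have AG : above a S x y (G x y).
  rewrite /above; apply/and3P; split; [lia | lia | apply/negP => Sg].
  have [i1 i2 i3] := ideal_box idS Sg.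
  move: Sg; rewrite SG //.
  have -> : a + (x + G x y - a) - G x y = x by lia.
  have -> : a + G x y - (G x y + a - y) = y by lia.
  by rewrite ltnn.
apply/eqP; rewrite eqn_leq surface_le //= leqNgt; apply/negP => lt.
have := surface_above h; set s := surface a S x y in lt *.
rewrite /above => /and3P[h1 h2 /negP]; apply.
rewrite SG; [ | lia | lia | lia].
have -> : a + (x + s - a) - s = x by lia.
by have -> : a + s - (s + a - y) = y by lia.
Qed.

End Surface.

Definition height_ideal a (G : nat -> nat -> nat) i j k : bool :=
  [&& i < a, j < a, k < a & k < G (a + j - k) (a + k - i)].

Lemma height_ideal_cyclic a G : height a G -> cyclic_ideal a (height_ideal a G).
Proof.
move=> hG; split.
- by move=> i j k /and4P[].
(* Decreasing one coordinate of a cell by 1 moves its vertex along one edge direction, so each of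
   the three cases is one step inequality. *)
- have st1 i j k : height_ideal a G i.+1 j k -> height_ideal a G i j k.
    rewrite /height_ideal => /and4P[i1 j1 k1 g1].
    have := @height_stepy _ _ hG (a + j - k) (a + k - i.+1).
    have <- : a + k - i = (a + k - i.+1).+1 by lia.
    by rewrite /hex; lia.
  have st2 i j k : height_ideal a G i j.+1 k -> height_ideal a G i j k.
    rewrite /height_ideal => /and4P[i1 j1 k1 g1].
    have := @height_stepx _ _ hG (a + j - k) (a + k - i).
    have <- : a + j.+1 - k = (a + j - k).+1 by lia.
    by rewrite /hex; lia.
  have st3 i j k : height_ideal a G i j k.+1 -> height_ideal a G i j k.
    rewrite /height_ideal => /and4P[i1 j1 k1 g1].
    have := @height_stepxy _ _ hG (a + j - k.+1) (a + k - i).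
    have <- : a + j - k = (a + j - k.+1).+1 by lia.
    have <- : a + k.+1 - i = (a + k - i).+1 by lia.
    by rewrite /hex; lia.
  move=> i j k i' j' k' /subnKC <- /subnKC <- /subnKC <-.
  elim: (i' - i) => [|n IH]; last by rewrite addnS => /st1.
  rewrite addn0; elim: (j' - j) => [|n IH]; last by rewrite addnS => /st2.
  rewrite addn0; elim: (k' - k) => [|n IH]; last by rewrite addnS => /st3.
  by rewrite addn0.
- move=> i j k; rewrite /height_ideal.
  case: (ltnP i a) => i1; case: (ltnP j a) => j1; case: (ltnP k a) => k1 //=.
  have := @height_rot _ _ hG (a + k - i) (a + i - j) (a + j - k).
  by rewrite /hex; lia.
Qed.

(** * Plane partitions as cyclic ideals and as heights *)

Section PlanePartitions.
Variable a : nat.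
Implicit Type p : {ffun 'I_a * 'I_a -> 'I_a.+1}.

Definition cells p (i j k : nat) : bool :=
  if insub i is Some i' then if insub j is Some j' then k < p (i', j') else false
  else false.

Lemma cells_ord p (i j : 'I_a) k : cells p i j k = (k < p (i, j)).
Proof. by rewrite /cells !valK. Qed.

Lemma cells_box p i j k : cells p i j k -> [/\ i < a, j < a & k < a].
Proof.
rewrite /cells; case: insubP => // i' -> _; case: insubP => // j' -> _ h.
by split=> //; have := ltn_ord (p (i', j')); lia.
Qed.

Lemma cells_ideal p : is_pp p -> is_cs p -> cyclic_ideal a (cells p).
Proof.
move=> /forallP pp /forallP cs; split; first exact: cells_box.
- move=> i j k i' j' k' li lj lk h; have [i1 j1 k1] := cells_box h.
  have i0 : i < a by lia.
  have j0 : j < a by lia.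
  move: h; rewrite (cells_ord p (Ordinal i1) (Ordinal j1)).
  rewrite (cells_ord p (Ordinal i0) (Ordinal j0)).
  have /forallP/(_ (Ordinal j0))/forallP/(_ (Ordinal i1))/forallP/(_ (Ordinal j1)) := pp (Ordinal i0).
  by move=> /implyP /=; rewrite li lj => /(_ isT); lia.
- have imp i j k (i1 : i < a) (j1 : j < a) (k1 : k < a) : cells p i j k = cells p j k i.
    have /eqP := cs (Ordinal i1, Ordinal j1, Ordinal k1).
    by rewrite !inE /= (cells_ord p (Ordinal i1) (Ordinal j1)) (cells_ord p (Ordinal j1) (Ordinal k1)).
  move=> i j k; apply/idP/idP => h.
  + by have [? ? ?] := cells_box h; rewrite -imp.
  + by have [? ? ?] := cells_box h; rewrite imp.
Qed.

Lemma cells_inj p q : (forall i j k, cells p i j k = cells q i j k) -> p = q.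
Proof.
move=> e; apply/ffunP => -[i j]; apply: ord_inj.
have h1 := e i j (p (i, j)); have h2 := e i j (q (i, j)).
move: h1; rewrite (cells_ord p i j) (cells_ord q i j) ltnn => h1.
move: h2; rewrite (cells_ord p i j) (cells_ord q i j) ltnn => h2.
by apply/eqP; rewrite eqn_leq; apply/andP; split; rewrite leqNgt ?h2 -?h1.
Qed.

Definition ideal_pp (S : nat -> nat -> nat -> bool) : {ffun 'I_a * 'I_a -> 'I_a.+1} :=
  [ffun t : 'I_a * 'I_a => inord (find (fun k => ~~ S t.1 t.2 k) (iota 0 a))].

Section IdealPP.
Variable S : nat -> nat -> nat -> bool.
Hypothesis idS : cyclic_ideal a S.

Lemma ideal_ppE (i j : 'I_a) k : (k < ideal_pp S (i, j)) = S i j k.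
Proof.
rewrite ffunE /=; set P := fun k => ~~ _.
have le : find P (iota 0 a) <= a by rewrite -[X in _ <= X](size_iota 0) find_size.
rewrite inordK //; apply/idP/idP => [lt | Sk].
  have := before_find 0 lt; rewrite nth_iota /P; last by lia.
  by rewrite add0n; case: (S _ _ _).
have [_ _ ka] := ideal_box idS Sk.
rewrite ltnNge; apply/negP => le'.
have hs : has P (iota 0 a) by rewrite has_find size_iota; lia.
have := nth_find 0 hs; rewrite nth_iota; last by lia.
by rewrite add0n /P => /negP; apply; apply: (ideal_down idS) Sk.
Qed.

Lemma cells_ideal_pp i j k : cells (ideal_pp S) i j k = S i j k.
Proof.
apply/idP/idP => h.
  have [i1 j1 _] := cells_box h.
  by move: h; rewrite (cells_ord _ (Ordinal i1) (Ordinal j1)) ideal_ppE.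
have [i1 j1 _] := ideal_box idS h.
by rewrite (cells_ord _ (Ordinal i1) (Ordinal j1)) ideal_ppE.
Qed.

Lemma ideal_pp_is_pp : is_pp (ideal_pp S).
Proof.
apply/forallP => i; apply/forallP => j; apply/forallP => i'; apply/forallP => j'.
apply/implyP => /andP[li lj]; rewrite leqNgt; apply/negP; rewrite ideal_ppE => h.
have : S i j (ideal_pp S (i, j)) by apply: (ideal_down idS) h.
by rewrite -ideal_ppE ltnn.
Qed.

Lemma ideal_pp_is_cs : is_cs (ideal_pp S).
Proof.
apply/forallP => -[[i j] k]; apply/eqP; rewrite !inE /= !ideal_ppE.
exact: (ideal_rot idS).
Qed.

End IdealPP.

Lemma height_of_cspp p : is_pp p -> is_cs p -> height a (surface a (cells p)).
Proof. by move=> pp cs; apply: surface_height; apply: cells_ideal. Qed.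

Lemma surface_cells_inj p q : is_pp p -> is_cs p -> is_pp q -> is_cs q ->
  (forall x y, hex a x y -> surface a (cells p) x y = surface a (cells q) x y) ->
  p = q.
Proof.
move=> pp cp pq cq e; apply: cells_inj => i j k.
rewrite (surface_mem (cells_ideal pp cp)) (surface_mem (cells_ideal pq cq)).
case: (ltnP i a) => i1; case: (ltnP j a) => j1; case: (ltnP k a) => k1 //=.
by rewrite e // /hex; lia.
Qed.

Lemma cspp_of_height G : height a G -> exists p, [/\ is_pp p, is_cs p
  & forall x y, hex a x y -> surface a (cells p) x y = G x y].
Proof.
move=> hG; have idS := height_ideal_cyclic hG.
exists (ideal_pp (height_ideal a G)); have pp := ideal_pp_is_pp idS.
have cs := ideal_pp_is_cs idS; split=> //.
apply: surface_unique (cells_ideal pp cs) _ hG _ => i j k i1 j1 k1.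
by rewrite cells_ideal_pp // /height_ideal i1 j1 k1.
Qed.

End PlanePartitions.

(** All three coordinates of the surface point are positive, as they must be at the outer corner of
    a removable cube. *)
Definition raised a (G : nat -> nat -> nat) x y : bool :=
  [&& hex a x y, 0 < G x y, y < G x y + a & a < G x y + x].

Definition separated (W : nat -> nat -> bool) : Prop := forall x y,
  [/\ W x y -> W x y.+1 -> False, W x y -> W x.+1 y -> False
    & W x.+1 y -> W x y.+1 -> False].

(** * Removing a rotation orbit of cubes *)

Section Lowering.
Variables (a : nat) (G : nat -> nat -> nat).
Hypothesis hG : height a G.

(* [3 * G x y + x - y] is the sum of the three coordinates of the surface point. *)
Lemma max_raised x y : raised a G x y -> exists x0 y0, raised a G x0 y0 /\
  forall x' y', raised a G x' y' -> 3 * G x' y' + x' + y0 <= 3 * G x0 y0 + x0 + y'.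
Proof.
move=> h.
have xy x' y' : raised a G x' y' -> (x' < (2 * a).+1) /\ (y' < (2 * a).+1).
  by rewrite /raised /hex; lia.
have [hx hy] := xy _ _ h.
pose P (v : 'I_(2 * a).+1 * 'I_(2 * a).+1) := raised a G v.1 v.2.
pose F (v : 'I_(2 * a).+1 * 'I_(2 * a).+1) := 3 * G v.1 v.2 + v.1 + (2 * a - v.2).
have Pv : P (Ordinal hx, Ordinal hy) by [].
case: (arg_maxnP F Pv) => -[x0 y0] P0 max; exists x0, y0; split=> // x' y' h'.
have [hx' hy'] := xy _ _ h'.
have := max (Ordinal hx', Ordinal hy') h'; rewrite /F /=.
by move: (P0) (h'); rewrite /P /raised /hex /=; lia.
Qed.

(** If lowering a vertex of maximal coordinate sum broke a step inequality, the neighbour concerned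
    would arise by adding 1 to one or two coordinates, hence would be raised with a larger sum. *)
Lemma lower_height x y : raised a G x y -> exists W : nat -> nat -> bool,
  [/\ forall x' y', W x' y' -> raised a G x' y', exists x' y', W x' y', separated W
    & height a (fun x' y' => G x' y' - W x' y')].
Proof.
move=> /max_raised[x0 [y0 [r0 max0]]].
pose z0 := 3 * a - x0 - y0.
have e0 : x0 + y0 + z0 = 3 * a by move: r0; rewrite /raised /hex /z0; lia.
have h0 : hex a x0 y0 by case/and4P: r0.
have h1 : hex a z0 x0 by move: h0; rewrite /hex; lia.
have h2 : hex a y0 z0 by move: h0; rewrite /hex; lia.
have R0 := height_rot hG h0 e0.
have R1 : G y0 z0 + a = G z0 x0 + z0 by apply: (height_rot hG h1); lia.
have R2 : G x0 y0 + a = G y0 z0 + y0 by apply: (height_rot hG h2); lia.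
(* At the centre [(a, a)] the three rotations coincide; since [W] is boolean, that vertex is still
   lowered only once. *)
pose W x y := [|| (x == x0) && (y == y0), (x == z0) && (y == x0) | (x == y0) && (y == z0)].
(* As x + y + z = 3a, the residue of x - y modulo 3 is rotation invariant, and it changes along
   every edge. *)
have sepW : separated W by move=> x1 y1; split; rewrite /W; lia.
have Wr x1 y1 : W x1 y1 -> raised a G x1 y1.
  move: r0; rewrite /W /raised => r0 /or3P[] /andP[/eqP-> /eqP->] //.
  - by rewrite h1; lia.
  - by rewrite h2; lia.
have Wm x1 y1 x2 y2 : W x1 y1 -> raised a G x2 y2 ->
    3 * G x2 y2 + x2 + y1 <= 3 * G x1 y1 + x1 + y2.
  move=> /or3P[] /andP[/eqP-> /eqP->] /max0 //; lia.
exists W; split=> //; first by exists x0, y0; rewrite /W !eqxx.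
have lt_gt x1 y1 : W x1 y1 -> 0 < G x1 y1 by move/Wr/and4P=> [].
have [b s1 s2 s3 rot] := hG.
split.
- move=> x1 y1 h; have [] := b _ _ h; case E: (W x1 y1); last by split; lia.
  by have := Wr _ _ E; rewrite /raised; split; lia.
- move=> x1 y1 h h'; have [n1 n2 n3] := sepW x1 y1; have := s1 _ _ h h'.
  case E: (W x1 y1); case E': (W x1 y1.+1).
  + by case: n1.
  + by have := Wr _ _ E; have := Wm _ _ x1 y1.+1 E; rewrite /raised h'; lia.
  + by have := Wr _ _ E'; have := Wm _ _ x1 y1 E'; rewrite /raised h; lia.
  + by lia.
- move=> x1 y1 h h'; have [n1 n2 n3] := sepW x1 y1; have := s2 _ _ h h'.
  case E: (W x1 y1); case E': (W x1.+1 y1).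
  + by case: n2.
  + by have := Wr _ _ E; have := Wm _ _ x1.+1 y1 E; rewrite /raised h'; lia.
  + by have := Wr _ _ E'; have := Wm _ _ x1 y1 E'; rewrite /raised h; lia.
  + by lia.
- move=> x1 y1 h h'; have [n1 n2 n3] := sepW x1 y1; have := s3 _ _ h h'.
  case E: (W x1.+1 y1); case E': (W x1 y1.+1).
  + by case: n3.
  + by have := Wr _ _ E; have := Wm _ _ x1 y1.+1 E; rewrite /raised h'; lia.
  + by have := Wr _ _ E'; have := Wm _ _ x1.+1 y1 E'; rewrite /raised h; lia.
  + by lia.
- move=> x1 y1 z1 h e; have := rot _ _ _ h e.
  have <- : W x1 y1 = W z1 x1 by rewrite /W; lia.
  have h' : hex a z1 x1 by move: h; rewrite /hex; lia.
  case E: (W x1 y1); last by lia.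
  have E' : W z1 x1 by move: E; rewrite /W; lia.
  by have := Wr _ _ E; have := Wr _ _ E'; rewrite /raised; lia.
Qed.

End Lowering.

(** * Matchings of triangles *)

Definition ord_down n (i : 'I_n) : 'I_n :=
  Ordinal (leq_ltn_trans (leq_pred i) (ltn_ord i)).

(* The down-triangle of a monomial [d] of degree [3a - 1] has the vertices
   [d * x], [d * y] and [d * z]; the surface crosses exactly one of its edges, and
   [pull G d] is the up-triangle on the other side of that edge. *)
Definition pull a (G : nat -> nat -> nat) (d : expo a) : expo a :=
  if G (e1 d) (e2 d) < G (e1 d) (e2 d).+1 then (ord_down d.1.1, d.1.2, d.2)
  else if G (e1 d).+1 (e2 d) < G (e1 d) (e2 d) then (d.1.1, ord_down d.1.2, d.2)
  else (d.1.1, d.1.2, ord_down d.2).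

Lemma expo_eqP a (s t : expo a) : e1 s = e1 t -> e2 s = e2 t -> e3 s = e3 t -> s = t.
Proof.
case: s t => [[i j] k] [[i' j'] k']; rewrite /e1 /e2 /e3 /= => h1 h2 h3.
by congr (_, _, _); apply: ord_inj.
Qed.

Lemma expo_lt a (t : expo a) : [/\ e1 t < 2 * a, e2 t < 2 * a & e3 t < 2 * a].
Proof. by split; apply: ltn_ord. Qed.

Definition covers a (u d : expo a) : bool :=
  [|| [&& e1 d == (e1 u).+1, e2 d == e2 u & e3 d == e3 u],
      [&& e1 d == e1 u, e2 d == (e2 u).+1 & e3 d == e3 u]
    | [&& e1 d == e1 u, e2 d == e2 u & e3 d == (e3 u).+1]].

Lemma expo_exists a i j k : i < 2 * a -> j < 2 * a -> k < 2 * a ->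
  exists t : expo a, [/\ e1 t = i, e2 t = j & e3 t = k].
Proof. by move=> hi hj hk; exists (Ordinal hi, Ordinal hj, Ordinal hk). Qed.

Lemma deg_rot a (t : expo a) : deg (rotE t) = deg t.
Proof. by rewrite /deg /rotE /e1 /e2 /e3 /=; lia. Qed.

Section Pull.
Variables (a : nat) (G : nat -> nat -> nat).
Hypothesis hG : height a G.

(** Indexing by the exponents of [u] avoids predecessors. A diagonal edge changes [G] in the first
    two directions but preserves it in the third, whence the equality in [PullZ]. *)
Variant pull_spec (d u : expo a) : Prop :=
  | PullX of e1 d = (e1 u).+1 & e2 d = e2 u & e3 d = e3 u
    & G (e1 u).+1 (e2 u) < G (e1 u).+1 (e2 u).+1
  | PullY of e1 d = e1 u & e2 d = (e2 u).+1 & e3 d = e3 u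
    & G (e1 u).+1 (e2 u).+1 < G (e1 u) (e2 u).+1
  | PullZ of e1 d = e1 u & e2 d = e2 u & e3 d = (e3 u).+1
    & G (e1 u).+1 (e2 u) = G (e1 u) (e2 u).+1.

Lemma pullP d : deg d = 3 * a - 1 -> 0 < a -> pull_spec d (pull G d).
Proof.
rewrite /deg => dd a0; have [l1 l2 l3] := expo_lt d.
have [b s1 s2 s3 _] := hG.
set x := e1 d in dd l1 *; set y := e2 d in dd l2 *; set z := e3 d in dd l3 *.
have hx : hex a x.+1 y by rewrite /hex; lia.
have hy : hex a x y.+1 by rewrite /hex; lia.
have hz : hex a x y by rewrite /hex; lia.
have := s1 _ _ hz hy; have := s2 _ _ hz hx; have := s3 _ _ hx hy.
have [] := b _ _ hx; have [] := b _ _ hy; have [] := b _ _ hz.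
move=> *; rewrite /pull -/x -/y; case: ifPn => c1.
  (* At [x = 0] the bounds force [G] to be [a] at both ends of the edge, so a jump rules this out
     and [ord_down] really subtracts 1. *)
  have x0 : 0 < x by lia.
  have ex : x = (x.-1).+1 by lia.
  by apply: PullX; rewrite /e1 /e2 /e3 /= -/(e1 d) -/(e2 d) -/x -/y -?ex.
case: ifPn => c2.
  have y0 : 0 < y by lia.
  have ey : y = (y.-1).+1 by lia.
  by apply: PullY; rewrite /e1 /e2 /e3 /= -/(e1 d) -/(e2 d) -/x -/y -?ey.
have z0 : 0 < z by lia.
have ez : z = (z.-1).+1 by lia.
apply: PullZ; rewrite /e1 /e2 /e3 /= -/(e1 d) -/(e2 d) -/(e3 d) -/x -/y -/z -?ez //.
lia.
Qed.

Lemma pull_spec_fun d u u' : deg d = 3 * a - 1 -> 0 < a ->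
  pull_spec d u -> pull_spec d u' -> u = u'.
Proof.
rewrite /deg => dd a0; have [l1 l2 l3] := expo_lt d.
have [b s1 s2 s3 _] := hG.
have hx : hex a (e1 d).+1 (e2 d) by rewrite /hex; lia.
have hy : hex a (e1 d) (e2 d).+1 by rewrite /hex; lia.
have hz : hex a (e1 d) (e2 d) by rewrite /hex; lia.
have q1 := s1 _ _ hz hy; have q2 := s2 _ _ hz hx; have q3 := s3 _ _ hx hy.
case=> f1 f2 f3 g; rewrite -?f1 -?f2 -?f3 in g;
case=> f1' f2' f3' g'; rewrite -?f1' -?f2' -?f3' in g';
  by [apply: expo_eqP; lia | exfalso; lia].
Qed.

(** An up-triangle, too, has only one diagonal edge, by the step inequalities on its three
    vertices. *)
Lemma pull_spec_inj u d d' : deg u = 3 * a - 2 -> 0 < a ->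
  pull_spec d u -> pull_spec d' u -> d = d'.
Proof.
rewrite /deg => dd a0; have [l1 l2 l3] := expo_lt u.
have [b s1 s2 s3 _] := hG.
have hx : hex a (e1 u).+1 (e2 u).+1 by rewrite /hex; lia.
have hy : hex a (e1 u).+1 (e2 u) by rewrite /hex; lia.
have hz : hex a (e1 u) (e2 u).+1 by rewrite /hex; lia.
have q1 := s1 _ _ hy hx; have q2 := s2 _ _ hz hx; have q3 := s3 _ _ hy hz.
by case=> f1 f2 f3 g; case=> f1' f2' f3' g'; [apply: expo_eqP | exfalso | exfalso |
  exfalso | apply: expo_eqP | exfalso | exfalso | exfalso | apply: expo_eqP]; lia.
Qed.

Lemma pull_deg (d : expo a) : deg d = 3 * a - 1 -> 0 < a -> deg (pull G d) = 3 * a - 2.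
Proof. by move=> dd a0; case: (pullP dd a0) => *; move: dd; rewrite /deg; lia. Qed.

Lemma pull_covers (d : expo a) : deg d = 3 * a - 1 -> 0 < a -> covers (pull G d) d.
Proof.
by move=> dd a0; case: (pullP dd a0) => *; rewrite /covers; lia.
Qed.

Lemma pull_rot (d : expo a) : deg d = 3 * a - 1 -> 0 < a -> pull G (rotE d) = rotE (pull G d).
Proof.
move=> dd a0.
have drd : deg (rotE d) = 3 * a - 1 by rewrite deg_rot.
apply: (pull_spec_fun drd a0 (pullP drd a0)).
have := pullP dd a0; have := pull_deg dd a0; move: (pull G d) => u.
rewrite /deg => du; have [l1 l2 l3] := expo_lt u.
have R := height_rot hG.
have r1 := R (e1 u).+1 (e2 u).+1 (e3 u).
have r2 := R (e1 u).+1 (e2 u) (e3 u).+1.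
have r3 := R (e1 u) (e2 u).+1 (e3 u).+1.
have st := @height_stepx _ _ hG (e1 u) (e2 u).+1.
have rE (t : expo a) : [/\ e1 (rotE t) = e3 t, e2 (rotE t) = e1 t & e3 (rotE t) = e2 t] by [].
have [u1 u2 u3] := rE u; have [d1 d2 d3] := rE d.
move: r1 r2 r3 st; rewrite /hex => r1 r2 r3 st.
(* Rotation permutes the edge directions cyclically, and [height_rot] turns the diagonal condition
   of one into that of the next. *)
by case=> f1 f2 f3 g; [apply: PullY | apply: PullZ | apply: PullX];
  rewrite ?u1 ?u2 ?u3 ?d1 ?d2 ?d3; lia.
Qed.

Lemma pull_inj (d d' : expo a) : deg d = 3 * a - 1 -> deg d' = 3 * a - 1 -> 0 < a ->
  pull G d = pull G d' -> d = d'.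
Proof.
move=> dd dd' a0 e; apply: (pull_spec_inj (pull_deg dd a0) a0 (pullP dd a0)).
by rewrite e; apply: pullP.
Qed.

End Pull.

(** * Orbits of monomials *)

Lemma rot3 a (t : expo a) : rotE (rotE (rotE t)) = t.
Proof. by case: t => [[i j] k]. Qed.

Lemma covers_rot a (u d : expo a) : covers (rotE u) (rotE d) = covers u d.
Proof.
rewrite /covers; case: u d => [[i j] k] [[i' j'] k']; rewrite /rotE /e1 /e2 /e3 /=.
lia.
Qed.

Lemma covers_iter_rot a n (u d : expo a) :
  covers (iter n (@rotE a) u) (iter n (@rotE a) d) = covers u d.
Proof. by elim: n => //= n; rewrite covers_rot. Qed.

Lemma deg_iter_rot a n (t : expo a) : deg (iter n (@rotE a) t) = deg t.
Proof. by elim: n => //= n; rewrite deg_rot. Qed.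

Lemma orbitEP a (s t : expo a) :
  reflect (exists k : 'I_3, s = iter k (@rotE a) t) (s \in orbitE t).
Proof.
rewrite /orbitE !inE -orbA; apply: (iffP or3P) => [[] /eqP-> | [[[|[|[|k]]] lt] ->] //].
- by exists ord0.
- by exists (@Ordinal 3 1 isT).
- by exists (@Ordinal 3 2 isT).
- exact: Or31.
- exact: Or32.
- exact: Or33.
Qed.

Lemma orbitE_iter a n (t : expo a) : iter n (@rotE a) t \in orbitE t.
Proof.
elim: n => [|n] /=; first by rewrite !inE eqxx.
by rewrite !inE -orbA => /or3P[] /eqP->; rewrite ?rot3 ?eqxx ?orbT.
Qed.

Lemma orbitE_refl a (t : expo a) : t \in orbitE t.
Proof. exact: (orbitE_iter 0). Qed.

Lemma orbitE_sym a (s t : expo a) : s \in orbitE t -> t \in orbitE s.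
Proof. by rewrite !inE -orbA => /or3P[] /eqP->; rewrite ?rot3 ?eqxx ?orbT. Qed.

Lemma orbitE_trans a (s t u : expo a) :
  s \in orbitE t -> t \in orbitE u -> s \in orbitE u.
Proof.
move=> /orbitEP[k ->] /orbitEP[k' ->].
by rewrite -iterD; apply: orbitE_iter.
Qed.

Lemma deg_orbitE a (s t : expo a) : s \in orbitE t -> deg s = deg t.
Proof. by case/orbitEP => k ->; rewrite deg_iter_rot. Qed.

(** A monomial fixed by a nontrivial rotation has three equal exponents, so its degree is a multiple
    of 3. *)
Lemma iter_rot_inj a (k k' : 'I_3) (t : expo a) : ~~ (3 %| deg t) ->
  iter k (@rotE a) t = iter k' (@rotE a) t -> k = k'.
Proof.
move=> h e; apply: ord_inj.
have ne : rotE t <> t.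
  move=> e'; move: h; have := congr1 (@e1 a) e'; have := congr1 (@e2 a) e'.
  by rewrite /deg /rotE /e1 /e2 /e3 /=; lia.
have ne2 : rotE (rotE t) <> t by move=> e'; apply: ne; rewrite -{1}e' rot3.
have ne3 : rotE (rotE t) <> rotE t by move=> e'; apply: ne2; rewrite e'; rewrite -[RHS]rot3 e' e'.
by move: e; case: k k' => [[|[|[|k]]] //= _] [[|[|[|k']]] //= _] // /esym.
Qed.

Lemma mulnDr_inj n q r q' r' : r < n -> r' < n -> q * n + r = q' * n + r' ->
  q = q' /\ r = r'.
Proof.
move=> h h' e; have eq : q = q' by nia.
by split=> //; move: e; rewrite eq; lia.
Qed.

Lemma code_inj a : injective (@code a).
Proof.
move=> s t; have [s1 s2 s3] := expo_lt s; have [t1 t2 t3] := expo_lt t.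
rewrite /code -!mulnDl => /mulnDr_inj[] // /mulnDr_inj[] // ? ? ?.
exact: expo_eqP.
Qed.

Lemma isrep_uniq a (s t : expo a) : isrep s -> isrep t -> s \in orbitE t -> s = t.
Proof.
move=> /andP[s1 s2] /andP[t1 t2] h; apply: code_inj; move: s1 s2 t1 t2.
by move: h; rewrite !inE -orbA => /or3P[] /eqP->; rewrite ?rot3; lia.
Qed.

Lemma isrep_ex a (t : expo a) : exists2 r, isrep r & r \in orbitE t.
Proof.
have [r ro rm] := arg_minnP (@code a) (orbitE_refl t).
exists r => //; apply/andP; split; apply: rm; apply: orbitE_trans ro.
  exact: (orbitE_iter 1).
exact: (orbitE_iter 2).
Qed.

Definition bvec a m (i : 'I_#|basisC3 a m|) : expo a := enum_val i.

Lemma bvec_deg a m (i : 'I_#|basisC3 a m|) : deg (bvec i) = m.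
Proof. by have := enum_valP i; rewrite !inE => /andP[/eqP]. Qed.

Lemma bvec_ex a m (t : expo a) : deg t = m ->
  exists i : 'I_#|basisC3 a m|, t \in orbitE (bvec i).
Proof.
move=> dt; have [r rr ro] := isrep_ex t.
have rb : r \in basisC3 a m by rewrite !inE rr (deg_orbitE ro) dt eqxx.
by exists (enum_rank_in rb r); rewrite /bvec enum_rankK_in // orbitE_sym.
Qed.

Lemma bvec_uniq a m (i i' : 'I_#|basisC3 a m|) t :
  t \in orbitE (bvec i) -> t \in orbitE (bvec i') -> i = i'.
Proof.
move=> h h'; apply: enum_val_inj; apply: isrep_uniq.
- by have := enum_valP i; rewrite !inE => /andP[].
- by have := enum_valP i'; rewrite !inE => /andP[].
- by apply: orbitE_trans h'; apply: orbitE_sym.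
Qed.

(* Complementing exponents, i.e. Poincare duality, exchanges the two degrees. *)
Lemma card_basisC3_dual a m m' : m + m' = 3 * (2 * a).-1 -> 0 < a ->
  #|basisC3 a m| <= #|basisC3 a m'|.
Proof.
move=> e a0; pose co (t : expo a) : expo a := (rev_ord t.1.1, rev_ord t.1.2, rev_ord t.2).
have coK t : co (co t) = t by case: t => [[i j] k]; rewrite /co /= !rev_ordK.
have coR t n : co (iter n (@rotE a) t) = iter n (@rotE a) (co t).
  by elim: n => //= n <-.
have coD t : deg t = m -> deg (co t) = m'.
  have [] := expo_lt t; move: e; rewrite /deg /e1 /e2 /e3 /=; lia.
have [f fP] : exists f : 'I_#|basisC3 a m| -> 'I_#|basisC3 a m'|,
    forall i, co (bvec i) \in orbitE (bvec (f i)).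
  apply: (fin_all_exists (P := fun i j => co (bvec i) \in orbitE (bvec j))) => i.
  by apply: bvec_ex; apply: coD; apply: bvec_deg.
have finj : injective f.
  move=> i i' ff; have := fP i; have := fP i'; rewrite -ff => h h'.
  have /orbitEP[k hk] := orbitE_trans h (orbitE_sym h').
  apply: (@bvec_uniq _ _ i i' (bvec i')); last exact: orbitE_refl.
  by apply/orbitEP; exists k; rewrite -[LHS]coK hk coR coK.
by have := leq_card f finj; rewrite !card_ord.
Qed.

Lemma card_basisC3 a : 0 < a ->
  #|basisC3 a (3 * a - 2)| = #|basisC3 a (3 * a - 2).+1|.
Proof.
by move=> a0; apply/eqP; rewrite eqn_leq !card_basisC3_dual //; lia.
Qed.

(** * The determinant as a signed sum over matchings *)

Local Open Scope ring_scope.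

(** Multilinearity in the columns: column [j] is a sum of 0-1 vectors indexed by the [s] with
    [P s j], and [g] selects one summand in each column. *)
Lemma det_sum_choice (R : comNzRingType) n (T : finType) (Q : 'I_n -> pred T)
    (P : T -> pred 'I_n) :
  \det (\matrix_(i, j) \sum_s ((Q i s && P s j)%:R : R)) =
  \sum_(g : {ffun 'I_n -> T} | [forall j, P (g j) j])
    \det (\matrix_(i, j) ((Q i (g j))%:R : R)).
Proof.
transitivity (\sum_(s : 'S_n) \sum_(g : {ffun 'I_n -> T} | [forall j, P (g j) j])
    (-1) ^+ s * \prod_j ((Q (s j) (g j))%:R : R)).
  rewrite -det_tr; apply: eq_bigr => s _.
  under eq_bigr => j _ do rewrite !mxE.
  rewrite bigA_distr_bigA big_distrr [RHS]big_mkcond /=; apply: eq_bigr => g _.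
  case: ifPn => [/forallP Pg | /forallPn[j nP]].
    by congr (_ * _); apply: eq_bigr => j _; rewrite Pg andbT.
  by rewrite (bigD1 j) //= (negPf nP) andbF mul0r mulr0.
rewrite exchange_big /=; apply: eq_bigr => g _.
rewrite -det_tr; apply: eq_bigr => s _.
by congr (_ * _); apply: eq_bigr => j _; rewrite !mxE.
Qed.

(** Each [g j] belongs to a single class, so every column is a unit vector. *)
Lemma det_perm_choice (R : comNzRingType) n (T : Type) (Q : 'I_n -> pred T)
    (g : 'I_n -> T) (s : 'S_n) :
  (forall j, Q (s j) (g j)) -> (forall i i' t, Q i t -> Q i' t -> i = i') ->
  \det (\matrix_(i, j) ((Q i (g j))%:R : R)) = (-1) ^+ s.
Proof.
move=> Qs Qu; rewrite -det_perm -det_tr; congr (\det _); apply/matrixP => i j.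
rewrite !mxE; congr (_%:R); congr (nat_of_bool _).
by apply/idP/eqP => [h | <- //]; apply: Qu h.
Qed.

Lemma det_choice_neq0 (R : comNzRingType) n (T : Type) (Q : 'I_n -> pred T)
    (g : 'I_n -> T) : \det (\matrix_(i, j) ((Q i (g j))%:R : R)) != 0 ->
  exists s : 'S_n, forall j, Q (s j) (g j).
Proof.
rewrite -det_tr => h.
have /existsP[s /forallP Hs] : [exists s : 'S_n, [forall j, Q (s j) (g j)]].
  apply: contraR h => /existsPn h; apply/eqP; apply: big1 => s _.
  have /forallPn[j nQ] := h s.
  by rewrite (bigD1 j) //= !mxE (negPf nQ) mul0r mulr0.
by exists s.
Qed.

(* [s' s^-1] has order dividing 3, so it is even. *)
Lemma odd_perm_3cycles n (s s' : 'S_n) :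
  (forall j, exists j1 j2, [/\ s' j = s j1, s' j1 = s j2 & s' j2 = s j]) ->
  odd_perm s' = odd_perm s.
Proof.
move=> h; pose p := (s' * s^-1)%g.
have p3 : (p * p * p)%g = 1%g.
  apply/permP => j; have [j1 [j2 [h1 h2 h3]]] := h j.
  by rewrite !permM perm1 h1 permK h2 permK h3 permK.
have : odd_perm (p * p * p)%g = false by rewrite p3 odd_perm1.
by rewrite !odd_permM odd_permV; case: (odd_perm s); case: (odd_perm s').
Qed.

Lemma xyz_coef a (s c : expo a) :
  \sum_(u : expo a | [&& (e1 s + e1 u == e1 c)%N, (e2 s + e2 u == e2 c)%N
        & (e3 s + e3 u == e3 c)%N]) xyz a u = (covers s c)%:R.
Proof.
case: (boolP (covers s c)) => h.
  have [||| u [u1 u2 u3]] := @expo_exists a (e1 c - e1 s) (e2 c - e2 s) (e3 c - e3 s);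
    try by have [] := expo_lt c; lia.
  rewrite (big_pred1 u) => [|v].
    by rewrite ffunE /deg u1 u2 u3; case: ifP => //; move: h; rewrite /covers; lia.
  apply/idP/eqP => [e | ->]; first by apply: expo_eqP; lia.
  by move: h; rewrite /covers; lia.
rewrite big1 // => u /and3P[/eqP h1 /eqP h2 /eqP h3]; rewrite ffunE /deg.
by case: ifP => //; move: h; rewrite /covers; lia.
Qed.

Lemma UmatE a m i j :
  Umat a m i j = \sum_s ((s \in orbitE (bvec i)) && covers s (bvec j))%:R.
Proof.
rewrite mxE ffunE; apply: eq_bigr => s _.
rewrite -big_distrr /= xyz_coef ffunE -/(bvec i) -/(bvec j).
by case: ifP; rewrite ?mul1r ?mul0r.
Qed.

(** * From matchings to heights *)

Local Open Scope nat_scope.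

Record matching a (M : expo a -> expo a -> bool) : Prop := Matching {
  matching_covers : forall u d, M u d -> covers u d;
  matching_deg : forall u d, M u d -> deg d = 3 * a - 1;
  matching_down : forall d, deg d = 3 * a - 1 -> exists u, M u d;
  matching_up : forall u, deg u = 3 * a - 2 -> exists d, M u d;
  matching_down_uniq : forall u u' d, M u d -> M u' d -> u = u';
  matching_up_uniq : forall u d d', M u d -> M u d' -> d = d';
  matching_rot : forall u d, M u d -> M (rotE u) (rotE d) }.

Section HeightOfMatching.
Variables (a : nat) (M : expo a -> expo a -> bool).
Hypotheses (a0 : 0 < a) (hM : matching M).

(** Two exponents name a down-triangle, its degree giving the third; [e] names the edge through
    which it is matched. *)
Definition crossing (e : expo a -> nat) x y : bool :=
  [exists u, exists d, [&& M u d, e1 d == x, e2 d == y & e d == (e u).+1]].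

Local Notation cx := (crossing (@e1 a)).
Local Notation cy := (crossing (@e2 a)).
Local Notation cz := (crossing (@e3 a)).

Lemma crossingP e x y : reflect (exists u d, [/\ M u d, e1 d = x, e2 d = y & e d = (e u).+1])
  (crossing e x y).
Proof.
apply: (iffP existsP) => [[u /existsP[d /and4P[h /eqP ? /eqP ? /eqP ?]]] | [u [d [h h1 h2 h3]]]].
  by exists u, d.
by exists u; apply/existsP; exists d; apply/and4P; split=> //; apply/eqP.
Qed.

Lemma crossing_range e x y : crossing e x y -> [/\ x < 2 * a, y < 2 * a, a <= x + y & x + y < 3 * a].
Proof.
case/crossingP => u [d [/(matching_deg hM) dd <- <- _]].
by have [] := expo_lt d; move: dd; rewrite /deg; split; lia.
Qed.

Lemma crossing_x0 y : cx 0 y = false.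
Proof. by apply/crossingP => -[u [d [_ -> _]]]. Qed.

Lemma crossing_y0 x : cy x 0 = false.
Proof. by apply/crossingP => -[u [d [_ _ ->]]]. Qed.

Lemma crossing_z0 x y : x + y = 3 * a - 1 -> cz x y = false.
Proof.
move=> e; apply/crossingP => -[u [d [/(matching_deg hM) dd f1 f2 f3]]].
by move: dd; rewrite /deg; lia.
Qed.

Lemma crossing_down x y : x < 2 * a -> y < 2 * a -> a <= x + y -> x + y < 3 * a ->
  cx x y + cy x y + cz x y = 1.
Proof.
move=> lx ly la lb.
have [||| d [d1 d2 d3]] := @expo_exists a x y (3 * a - 1 - x - y); try by lia.
have dd : deg d = 3 * a - 1 by rewrite /deg; lia.
have [u hu] := matching_down hM dd.
have det e : crossing e x y = (e d == (e u).+1).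
  apply/crossingP/eqP => [[u' [d' [h' f1 f2 f3]]] | h]; last by exists u, d.
  have ed : d' = d.
    by have := matching_deg hM h'; move=> dd'; apply: expo_eqP; move: dd dd'; rewrite /deg; lia.
  by rewrite ed in h' f3; rewrite (matching_down_uniq hM hu h').
rewrite !det; have := matching_covers hM hu; rewrite /covers; lia.
Qed.

(** The down-triangles around the up-triangle [(x, y)] are named [(x.+1, y)], [(x, y.+1)] and
    [(x, y)], which explains the shifts. *)
Lemma crossing_up x y : x < 2 * a -> y < 2 * a -> a < x + y + 2 -> x + y + 2 <= 3 * a ->
  cx x.+1 y + cy x y.+1 + cz x y = 1.
Proof.
move=> lx ly la lb; have [||| u [u1 u2 u3]] := @expo_exists a x y (3 * a - 2 - x - y);
  try by lia.
have du : deg u = 3 * a - 2 by rewrite /deg; lia.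
have [d hd] := matching_up hM du.
have det e x' y' :
    (forall u' d', M u' d' -> e1 d' = x' -> e2 d' = y' -> e d' = (e u').+1 -> u' = u) ->
    crossing e x' y' = [&& e1 d == x', e2 d == y' & e d == (e u).+1].
  move=> H; apply/crossingP/and3P => [[u' [d' [h' f1 f2 f3]]] | [/eqP ? /eqP ? /eqP ?]].
    have eu := H _ _ h' f1 f2 f3; rewrite eu in h' f3.
    by rewrite (matching_up_uniq hM hd h') f1 f2 f3.
  by exists u, d.
have cov := matching_covers hM; have dg := matching_deg hM.
rewrite !det; first by have := cov _ _ hd; rewrite /covers; lia.
- move=> u' d' h' f1 f2 f3; have := cov _ _ h'; have := dg _ _ h'.
  by rewrite /covers /deg => ? ?; apply: expo_eqP; lia.
- move=> u' d' h' f1 f2 f3; have := cov _ _ h'; have := dg _ _ h'.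
  by rewrite /covers /deg => ? ?; apply: expo_eqP; lia.
- move=> u' d' h' f1 f2 f3; have := cov _ _ h'; have := dg _ _ h'.
  by rewrite /covers /deg => ? ?; apply: expo_eqP; lia.
Qed.

Lemma crossing_rot x y z : x + y + z = 3 * a - 1 -> cx x y = cy z x.
Proof.
move=> e; apply/crossingP/crossingP => -[u [d [h f1 f2 f3]]].
  exists (rotE u), (rotE d); split=> //; first exact: matching_rot.
  by have := matching_deg hM h; move: e; rewrite -f1 -f2 /deg /rotE /e1 /e2 /e3 /=; lia.
exists (rotE (rotE u)), (rotE (rotE d)); split=> //.
  by apply: matching_rot (matching_rot hM h).
by have := matching_deg hM h; move: e; rewrite -f1 -f2 /deg /rotE /e1 /e2 /e3 /=; lia.
Qed.

(** Along a line of constant [x] the height grows by 1 at each crossed edge. The line enters the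
    hexagon at [y = a - x] with height [a - x] if [x <= a], and otherwise at [y = 0] with height 0;
    truncated subtraction covers both, and terms below the hexagon vanish. *)
Definition matching_height x y := (a - x) + \sum_(j < y) cx x j.
Local Notation H := matching_height.

Lemma mh_stepy x y : H x y.+1 = H x y + cx x y.
Proof. by rewrite /H big_ord_recr /= addnA. Qed.

Lemma mh_bottom x y : y <= a - x -> H x y = a - x.
Proof.
move=> le; rewrite /H big1 ?addn0 // => j _.
by case E: (cx x j) => //; have [] := crossing_range E; have := ltn_ord j; lia.
Qed.

(** Path independence: between the two lines lie a down- and an up-triangle, and their counts share
    the term [cz x y], which cancels in the induction step. *)
Lemma mh_stepx x y : hex a x y -> hex a x.+1 y -> H x y = H x.+1 y + cy x y.
Proof.
elim: y => [|y IH] h h'.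
  by rewrite crossing_y0 /H !big_ord0; move: h; rewrite /hex; lia.
case: (leqP a (x + y)) => le.
  have := IH; have := @crossing_down x y; have := @crossing_up x y.
  by rewrite !mh_stepy; move: h h'; rewrite /hex; lia.
have z : cz x y = false by apply/negbTE/negP => /crossing_range[]; lia.
have := @crossing_up x y; rewrite z mh_bottom; last by lia.
rewrite mh_stepy mh_bottom; last by lia.
by move: h h'; rewrite /hex; lia.
Qed.

Lemma mh_x0 y : H 0 y = a.
Proof. by rewrite /H big1 ?addn0 ?subn0 // => j _; rewrite crossing_x0. Qed.

Lemma mh_x2a y : H (2 * a) y = 0.
Proof.
rewrite /H big1 => [|j _]; first by lia.
by case E: (cx (2 * a) j) => //; have [] := crossing_range E; lia.
Qed.

Lemma mh_top1 x : x <= a -> H x (2 * a) = a.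
Proof.
elim: x => [|x IH] le; first exact: mh_x0.
have c : cy x (2 * a) = false by apply/negbTE/negP => /crossing_range[]; lia.
by have := @mh_stepx x (2 * a); rewrite c /hex; lia.
Qed.

(** On the side z = 0 no z-edge is crossed, so exactly one of [cx] and [cy] holds, and either way
    the height drops by 1. *)
Lemma mh_top2 k : k <= a -> H (a + k) (2 * a - k) = a - k.
Proof.
elim: k => [|k IH] le; first by rewrite addn0 !subn0 mh_top1.
have := mh_stepy (a + k) (2 * a - k.+1).
have -> : (2 * a - k.+1).+1 = 2 * a - k by lia.
rewrite IH ?(ltnW le) //.
have := @mh_stepx (a + k) (2 * a - k.+1); rewrite -addnS.
have := @crossing_down (a + k) (2 * a - k.+1).
by rewrite crossing_z0 /hex; lia.
Qed.

Lemma mh_mono x y n : H x y <= H x (y + n) <= H x y + n.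
Proof.
elim: n => [|n IH]; first by rewrite !addn0 leqnn.
by rewrite addnS mh_stepy; case: (cx _ _); lia.
Qed.

(** When [y] grows by 1, the right side gains [cx x y] and the left side gains [cy z x], the same
    crossing after rotation. *)
Lemma mh_rot x y z : hex a x y -> x + y + z = 3 * a -> H z x + a = H x y + x.
Proof.
elim: y z => [|y IH] z h e.
  have := @mh_top2 (2 * a - x); have -> : a + (2 * a - x) = z by move: h; rewrite /hex; lia.
  have -> : 2 * a - (2 * a - x) = x by move: h; rewrite /hex; lia.
  by rewrite /(H x 0) big_ord0; move: h; rewrite /hex; lia.
case: (leqP a (x + y)) => le.
  have := IH z.+1; have := @mh_stepx z x; rewrite mh_stepy (@crossing_rot x y z); last by lia.
  by move: h; rewrite /hex; lia.
rewrite (@mh_bottom x y.+1); last by move: h; rewrite /hex; lia.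
have -> : z = 2 * a by move: h; rewrite /hex; lia.
by rewrite mh_x2a; move: h; rewrite /hex; lia.
Qed.

Lemma matching_heightP : height a H.
Proof.
split.
- move=> x y h; have lo : a - x <= H x y by rewrite /H leq_addr.
  have up : H x y <= y.
    case: (leqP (a - x) y) => le; last by move: h; rewrite /hex; lia.
    have := mh_mono x (a - x) (y - (a - x)); rewrite subnKC //.
    by have := @mh_bottom x (a - x); move: h; rewrite /hex; lia.
  (* The height is known where the line of constant [x] leaves the hexagon; growth by 0 or 1 per
     step bounds [H x y] from both sides. *)
  case: (leqP x a) => le.
    have := mh_mono x y (2 * a - y); rewrite subnKC; last by move: h; rewrite /hex; lia.
    by rewrite mh_top1 //; split; move: h; rewrite /hex; lia.
  have := mh_mono x y (3 * a - x - y); rewrite subnKC; last by move: h; rewrite /hex; lia.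
  have := @mh_top2 (x - a); rewrite subnKC; last by lia.
  have -> : 2 * a - (x - a) = 3 * a - x by lia.
  by split; move: h; rewrite /hex; lia.
- by move=> x y h h'; rewrite mh_stepy; case: (cx x y); lia.
- by move=> x y h h'; rewrite (mh_stepx h h'); case: (cy x y); lia.
- move=> x y h h'; case: (leqP a (x + y)) => le; last first.
    by rewrite !mh_bottom; move: h h'; rewrite /hex; lia.
  have := @mh_stepx x y; rewrite mh_stepy.
  by have := @crossing_down x y; move: h h'; rewrite /hex; lia.
- exact: mh_rot.
Qed.

Lemma matching_pull u d : M u d -> pull H d = u.
Proof.
move=> h; have dd := matching_deg hM h.
apply: (pull_spec_fun matching_heightP dd a0 (pullP matching_heightP dd a0)).
have [l1 l2 l3] := expo_lt d; move: (dd); rewrite /deg => dd'.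
have cd := @crossing_down (e1 d) (e2 d).
have sx := @mh_stepx (e1 d) (e2 d); have sy := mh_stepy (e1 d) (e2 d).
rewrite /hex in sx.
have /or3P[] := matching_covers hM h => /and3P[/eqP f1 /eqP f2 /eqP f3].
- have c : cx (e1 d) (e2 d) by apply/crossingP; exists u, d.
  by apply: PullX; rewrite // -f1 -f2; lia.
- have c : cy (e1 d) (e2 d) by apply/crossingP; exists u, d.
  by apply: PullY; rewrite // -f1 -f2; lia.
- have c : cz (e1 d) (e2 d) by apply/crossingP; exists u, d.
  by apply: PullZ; rewrite // -f1 -f2; lia.
Qed.

End HeightOfMatching.

(** * Flipping a hexagon *)

Lemma pull_ext a G G' (d : expo a) : (forall x y, hex a x y -> G x y = G' x y) ->
  0 < a -> deg d = 3 * a - 1 -> pull G d = pull G' d.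
Proof.
move=> e a0; rewrite /deg => dd; have [l1 l2 l3] := expo_lt d.
by rewrite /pull !e //; rewrite /hex; lia.
Qed.

Lemma pull_iter_rot a G n (d : expo a) : height a G -> 0 < a -> deg d = 3 * a - 1 ->
  pull G (iter n (@rotE a) d) = iter n (@rotE a) (pull G d).
Proof.
move=> hG a0 dd; elim: n => //= n <-.
by apply: pull_rot => //; rewrite deg_iter_rot.
Qed.

(** The bounds fix the height where a line of constant [x] enters the hexagon, and the pull of the
    down-triangle [(x, y)] decides whether it jumps next. *)
Lemma pull_height_inj a G G' : height a G -> height a G' -> 0 < a ->
  (forall d : expo a, deg d = 3 * a - 1 -> pull G d = pull G' d) ->
  forall x y, hex a x y -> G x y = G' x y.
Proof.
move=> hG hG' a0 e x; elim=> [|y IH] h.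
  by have [] := height_bounds hG h; have [] := height_bounds hG' h; lia.
have [? ? ? ? ?] := height_bounds hG h; have [? ? ? ? ?] := height_bounds hG' h.
case: (ltnP (x + y) a) => la; first by lia.
case: (ltnP x (2 * a)) => lx; last by lia.
move: (h); rewrite /hex => hh.
have [||| d [d1 d2 d3]] := @expo_exists a x y (3 * a - 1 - x - y); try by lia.
have dd : deg d = 3 * a - 1 by rewrite /deg; lia.
have hxy : hex a x y by rewrite /hex; lia.
have hxy' : hex a x.+1 y by rewrite /hex; lia.
have := pullP hG' dd a0; have := pullP hG dd a0; rewrite -e //.
have := IH hxy; have := height_stepy hG hxy h; have := height_stepx hG hxy hxy'.
have := height_stepxy hG hxy' h; have := height_stepy hG' hxy h.
have := height_stepx hG' hxy hxy'; have := height_stepxy hG' hxy' h.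
move: (pull G d) => u s3' s2' s1' s3 s2 s1 ih.
case=> f1 f2 f3 g; rewrite -?f1 -?f2 ?d1 ?d2 in g;
case=> f1' f2' f3' g'; rewrite -?f1' -?f2' ?d1 ?d2 in g'; lia.
Qed.

Section Flip.
Variables (a : nat) (G : nat -> nat -> nat) (W : nat -> nat -> bool).
Hypotheses (a0 : 0 < a) (hG : height a G).
Let G' x y := G x y - W x y.
Hypotheses (hG' : height a G') (sepW : separated W).
Hypothesis raisedW : forall x y, W x y -> raised a G x y.

(** The six triangles around a vertex form a 6-cycle, which has two perfect matchings; lowering the
    vertex exchanges them. *)
Lemma flip_at x y z (v1 v2 v3 : expo a) : W x.+1 y.+1 -> x + y + z + 3 = 3 * a ->
  e1 v1 = x -> e2 v1 = y.+1 -> e3 v1 = z.+1 ->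
  e1 v2 = x.+1 -> e2 v2 = y -> e3 v2 = z.+1 ->
  e1 v3 = x.+1 -> e2 v3 = y.+1 -> e3 v3 = z ->
  [/\ pull G' v3 = pull G v1, pull G' v1 = pull G v2 & pull G' v2 = pull G v3].
Proof.
move=> Wv es x1 y1 z1 x2 y2 z2 x3 y3 z3.
have [lx1 ly1 lz1] := expo_lt v1; have [lx2 ly2 lz2] := expo_lt v2.
have [lx3 ly3 lz3] := expo_lt v3.
have dv1 : deg v1 = 3 * a - 1 by rewrite /deg; lia.
have dv2 : deg v2 = 3 * a - 1 by rewrite /deg; lia.
have dv3 : deg v3 = 3 * a - 1 by rewrite /deg; lia.
have [||| u1 [u11 u12 u13]] := @expo_exists a x.+1 y z; try by lia.
have [||| u2 [u21 u22 u23]] := @expo_exists a x y.+1 z; try by lia.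
have [||| u3 [u31 u32 u33]] := @expo_exists a x y z.+1; try by lia.
have hh : [&& hex a x.+1 y.+1, hex a x.+1 y, hex a x y.+1, hex a x y.+2,
              hex a x.+1 y.+2, hex a x.+2 y.+1 & hex a x.+2 y] by rewrite /hex; lia.
have G0 : 0 < G x.+1 y.+1 by case/and4P: (raisedW Wv).
have [_ w2 _] := sepW x y.+1; have [w1 _ _] := sepW x.+1 y.
have [w4 w5 _] := sepW x.+1 y.+1; have [_ _ w3] := sepW x y.+1.
have [_ _ w6] := sepW x.+1 y.
have n1 : W x.+1 y = false by apply/negP => h; apply: w1.
have n2 : W x y.+1 = false by apply/negP => h; apply: w2.
have n3 : W x y.+2 = false by apply/negP => h; apply: w3.
have n4 : W x.+1 y.+2 = false by apply/negP => h; apply: w4.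
have n5 : W x.+2 y.+1 = false by apply/negP => h; apply: w5.
have n6 : W x.+2 y = false by apply/negP => h; apply: w6.
case/and5P: hh => h0 h1 h2 h3 /and3P[h4 h5 h6].
(* The step inequalities hold at the centre before and after lowering, which fixes the heights of
   all six neighbours. *)
have s1 := height_stepy hG h1 h0; have s1' := height_stepy hG' h1 h0.
have s2 := height_stepx hG h2 h0; have s2' := height_stepx hG' h2 h0.
have s3 := height_stepxy hG h0 h3; have s3' := height_stepxy hG' h0 h3.
have s4 := height_stepy hG h0 h4; have s4' := height_stepy hG' h0 h4.
have s5 := height_stepx hG h0 h5; have s5' := height_stepx hG' h0 h5.
have s6 := height_stepxy hG h6 h0; have s6' := height_stepxy hG' h6 h0.
rewrite /G' ?Wv ?n1 ?n2 ?n3 ?n4 ?n5 ?n6 in s1' s2' s3' s4' s5' s6'.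
clear w1 w2 w3 w4 w5 w6 h0 h1 h2 h3 h4 h5 h6.
have F := pull_spec_fun hG; have F' := pull_spec_fun hG'.
have P1 : pull G v1 = u2.
  apply: (F _ _ _ dv1 a0 (pullP hG dv1 a0)); apply: PullZ; rewrite ?u21 ?u22 ?u23 //; lia.
have P2 : pull G v2 = u3.
  apply: (F _ _ _ dv2 a0 (pullP hG dv2 a0)); apply: PullX; rewrite ?u31 ?u32 ?u33 //; lia.
have P3 : pull G v3 = u1.
  apply: (F _ _ _ dv3 a0 (pullP hG dv3 a0)); apply: PullY; rewrite ?u11 ?u12 ?u13 //; lia.
rewrite P1 P2 P3; split.
- apply: (F' _ _ _ dv3 a0 (pullP hG' dv3 a0)); apply: PullX; rewrite ?u21 ?u22 ?u23 //.
  by rewrite /G' Wv n4; lia.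
- apply: (F' _ _ _ dv1 a0 (pullP hG' dv1 a0)); apply: PullY; rewrite ?u31 ?u32 ?u33 //.
  by rewrite /G' Wv n2; lia.
- apply: (F' _ _ _ dv2 a0 (pullP hG' dv2 a0)); apply: PullZ; rewrite ?u11 ?u12 ?u13 //.
  by rewrite /G' Wv n6; lia.
Qed.

Lemma flip_3cycle (d : expo a) : deg d = 3 * a - 1 -> exists d1 d2,
  [/\ deg d1 = 3 * a - 1, deg d2 = 3 * a - 1
    & [/\ pull G' d = pull G d1, pull G' d1 = pull G d2 & pull G' d2 = pull G d]].
Proof.
move=> dd.
have cyc x y z : W x y -> x + y + z = 3 * a -> exists v1 v2 v3 : expo a,
    [/\ [/\ (e1 v1).+1 = x, e2 v1 = y & (e3 v1) = z],
        [/\ e1 v2 = x, (e2 v2).+1 = y & e3 v2 = z],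
        [/\ e1 v3 = x, e2 v3 = y & (e3 v3).+1 = z]
      & [/\ pull G' v3 = pull G v1, pull G' v1 = pull G v2 & pull G' v2 = pull G v3]].
  move=> Wxy es; have := raisedW Wxy => /and4P[h g1 g2 g3].
  have [b1 b2 b3 b4 b5] := height_bounds hG h; move: (h); rewrite /hex => hh.
  have [||| v1 [x1 y1 z1]] := @expo_exists a x.-1 y z; try by lia.
  have [||| v2 [x2 y2 z2]] := @expo_exists a x y.-1 z; try by lia.
  have [||| v3 [x3 y3 z3]] := @expo_exists a x y z.-1; try by lia.
  exists v1, v2, v3; split; [split; lia | split; lia | split; lia |].
  have ex : x = x.-1.+1 by lia.
  have ey : y = y.-1.+1 by lia.
  have ez : z = z.-1.+1 by lia.
  rewrite ex ey in Wxy; apply: (flip_at Wxy (z := z.-1)); rewrite -?ex -?ey -?ez //; lia.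
have [l1 l2 l3] := expo_lt d; move: (dd); rewrite /deg => dd'.
case W1: (W (e1 d).+1 (e2 d)).
  have [|v1 [v2 [v3 [[x1 y1 z1] [x2 y2 z2] [x3 y3 z3] [p1 p2 p3]]]]] := cyc _ _ (e3 d) W1.
    by lia.
  have -> : d = v1 by apply: expo_eqP; lia.
  by exists v2, v3; split; rewrite /deg; [lia | lia | split].
case W2: (W (e1 d) (e2 d).+1).
  have [|v1 [v2 [v3 [[x1 y1 z1] [x2 y2 z2] [x3 y3 z3] [p1 p2 p3]]]]] := cyc _ _ (e3 d) W2.
    by lia.
  have -> : d = v2 by apply: expo_eqP; lia.
  by exists v3, v1; split; rewrite /deg; [lia | lia | split].
case W3: (W (e1 d) (e2 d)).
  have [|v1 [v2 [v3 [[x1 y1 z1] [x2 y2 z2] [x3 y3 z3] [p1 p2 p3]]]]] := cyc _ _ (e3 d).+1 W3.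
    by lia.
  have -> : d = v3 by apply: expo_eqP; lia.
  by exists v1, v2; split; rewrite /deg; [lia | lia | split].
exists d, d; have e : pull G' d = pull G d by rewrite /pull /G' W1 W2 W3 !subn0.
by split.
Qed.

End Flip.

(** * Matchings modulo rotation *)

(** Rows and columns need one common index type to speak of permutations, whereas the two bases have
    cardinals that are only provably equal. *)
Record transversal_of a m n (f : 'I_n -> expo a) : Prop := Transversal {
  transv_deg : forall i, deg (f i) = m;
  transv_ex : forall t, deg t = m -> exists i, t \in orbitE (f i);
  transv_uniq : forall i i' t, t \in orbitE (f i) -> t \in orbitE (f i') -> i = i' }.

Section Quotient.
Variables (a n : nat) (row col : 'I_n -> expo a).
Hypotheses (a0 : 0 < a) (trow : transversal_of (3 * a - 2) row)
  (tcol : transversal_of (3 * a - 1) col).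

(** The Leibniz term to which the tiling of [G] contributes. *)
Definition pull_perm G (s : {perm 'I_n}) : Prop :=
  forall j, pull G (col j) \in orbitE (row (s j)).

Lemma pull_permP G s j d : height a G -> pull_perm G s -> d \in orbitE (col j) ->
  pull G d \in orbitE (row (s j)).
Proof.
move=> hG sG /orbitEP[k ->]; rewrite pull_iter_rot ?(transv_deg tcol) //.
by apply: orbitE_trans (orbitE_iter _ _) (sG j).
Qed.

Lemma pull_perm_ex G : height a G -> exists s, pull_perm G s.
Proof.
move=> hG; have dc := transv_deg tcol.
have [f fP] : exists f : 'I_n -> 'I_n, forall j, pull G (col j) \in orbitE (row (f j)).
  apply: (fin_all_exists (P := fun j i => pull G (col j) \in orbitE (row i))) => j.
  by apply: (transv_ex trow); apply: pull_deg.
have finj : injective f.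
  move=> j j' e; have h := fP j; have h' := fP j'; rewrite e in h.
  have /orbitEP[k hk] := orbitE_trans h (orbitE_sym h').
  rewrite -pull_iter_rot // in hk.
  have ce : col j = iter k (@rotE a) (col j').
    by apply: (pull_inj hG _ _ a0 hk); rewrite ?deg_iter_rot.
  apply: (transv_uniq tcol (orbitE_refl (col j))).
  by rewrite ce orbitE_iter.
by exists (perm finj) => j; rewrite permE.
Qed.

(** The 3-cycles of a flip descend to orbits; at the central vertex the three down-triangles form
    one orbit and the cycle becomes trivial. *)
Lemma pull_perm_flip G (W : nat -> nat -> bool) s s' : height a G -> height a (fun x y => G x y - W x y) ->
  separated W -> (forall x y, W x y -> raised a G x y) ->
  pull_perm G s -> pull_perm (fun x y => G x y - W x y) s' ->
  odd_perm s' = odd_perm s.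
Proof.
move=> hG hG' sepW rW sG sG'; apply: odd_perm_3cycles => j.
have [d1 [d2 [dd1 dd2 [p1 p2 p3]]]] := flip_3cycle a0 hG hG' sepW rW (transv_deg tcol j).
have [j1 o1] := transv_ex tcol dd1; have [j2 o2] := transv_ex tcol dd2.
have oj := orbitE_refl (col j).
exists j1, j2; split.
- apply: (transv_uniq trow (pull_permP hG' sG' oj)).
  by rewrite p1; apply: pull_permP.
- apply: (transv_uniq trow (pull_permP hG' sG' o1)).
  by rewrite p2; apply: pull_permP.
- apply: (transv_uniq trow (pull_permP hG' sG' o2)).
  by rewrite p3; apply: pull_permP.
Qed.

(** * Sign of a tiling, by descent to the empty pile *)

Definition volume (G : nat -> nat -> nat) : nat :=
  \sum_(v : 'I_(2 * a).+1 * 'I_(2 * a).+1) G v.1 v.2.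

(** Values of [G] off the hexagon are arbitrary but unchanged, as [W] holds only at raised
    vertices. *)
Lemma volume_lower G (W : nat -> nat -> bool) x y :
  (forall x' y', W x' y' -> raised a G x' y') -> W x y ->
  volume (fun x' y' => G x' y' - W x' y') < volume G.
Proof.
move=> rW Wxy.
have e : volume (fun x' y' => G x' y' - W x' y') + volume (fun x' y' => W x' y') = volume G.
  rewrite -big_split /=; apply: eq_bigr => v _.
  case E: (W v.1 v.2); last by lia.
  by have /and4P[_] := rW _ _ E; lia.
have /and4P[hxy _ _ _] := rW _ _ Wxy.
have lx : x < (2 * a).+1 by move: hxy; rewrite /hex; lia.
have ly : y < (2 * a).+1 by move: hxy; rewrite /hex; lia.
have : 0 < volume (fun x' y' => W x' y').
  by rewrite /volume (bigD1 (Ordinal lx, Ordinal ly)) //= Wxy.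
by lia.
Qed.

(** The least [G] making all three coordinates nonnegative, i.e. the walls of the box. *)
Definition empty_height x y := maxn (y - a) (a - x).

Lemma empty_heightP : height a empty_height.
Proof.
by rewrite /empty_height; split=> [x y h|x y|x y|x y|x y z];
  [split; move: h | | | |]; rewrite /hex; lia.
Qed.

Lemma unraised_empty G : height a G -> (forall x y, ~~ raised a G x y) ->
  forall x y, hex a x y -> G x y = empty_height x y.
Proof.
move=> hG nr x y h; have := nr x y; have [] := height_bounds hG h.
by rewrite /raised h /empty_height; move: h; rewrite /hex; lia.
Qed.

Lemma pull_perm_sign G s s0 : height a G -> pull_perm G s ->
  pull_perm empty_height s0 -> odd_perm s = odd_perm s0.
Proof.
move=> + + h0; elim/ltn_ind: (volume G) {-2}G (erefl (volume G)) s => v IH {}G vG s hG sG.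
case: (boolP [exists w : 'I_(2 * a).+1 * 'I_(2 * a).+1, raised a G w.1 w.2]) => [/existsP[w rw] | /existsPn nr].
  have [W [rW [x [y Wxy]] sepW hG']] := lower_height hG rw.
  have [s' sG'] := pull_perm_ex hG'.
  rewrite -(pull_perm_flip hG hG' sepW rW sG sG').
  by apply: (IH _ _ _ erefl _ hG' sG'); rewrite -vG (volume_lower rW Wxy).
congr odd_perm; apply/permP => j; apply: (transv_uniq trow (sG j)).
rewrite (@pull_ext _ _ empty_height) ?(transv_deg tcol) //.
apply: unraised_empty => // x y; apply/negP => r.
have /and4P[hxy _ _ _] := r.
have lx : x < (2 * a).+1 by move: hxy; rewrite /hex; lia.
have ly : y < (2 * a).+1 by move: hxy; rewrite /hex; lia.
by have := nr (Ordinal lx, Ordinal ly); rewrite r.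
Qed.

(** * Choices of divisors and plane partitions *)

Definition rot_closure (g : 'I_n -> expo a) (u d : expo a) : bool :=
  [exists j, exists k : 'I_3,
    (u == iter k (@rotE a) (g j)) && (d == iter k (@rotE a) (col j))].

Lemma rot_closureP g u d : reflect
  (exists j (k : 'I_3), u = iter k (@rotE a) (g j) /\ d = iter k (@rotE a) (col j))
  (rot_closure g u d).
Proof.
apply: (iffP existsP) => [[j /existsP[k /andP[/eqP ? /eqP ?]]] | [j [k [-> ->]]]].
  by exists j, k.
by exists j; apply/existsP; exists k; rewrite !eqxx.
Qed.

(** Since [s] is a permutation, the chosen monomials meet each row orbit once; freeness of the
    rotation in both degrees makes partners unique. *)
Lemma rot_closure_matching (g : 'I_n -> expo a) (s : {perm 'I_n}) :
  (forall j, covers (g j) (col j)) -> (forall j, g j \in orbitE (row (s j))) ->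
  matching (rot_closure g).
Proof.
move=> cov gs; have dc := transv_deg tcol; have dr := transv_deg trow.
have dg j : deg (g j) = 3 * a - 2 by rewrite (deg_orbitE (gs j)).
have nc j : ~~ (3 %| deg (col j)) by rewrite dc; lia.
have ng j : ~~ (3 %| deg (g j)) by rewrite dg; lia.
split.
- by move=> u d /rot_closureP[j [k [-> ->]]]; rewrite covers_iter_rot.
- by move=> u d /rot_closureP[j [k [_ ->]]]; rewrite deg_iter_rot.
- move=> d /(transv_ex tcol)[j /orbitEP[k ->]].
  by exists (iter k (@rotE a) (g j)); apply/rot_closureP; exists j, k.
- move=> u /(transv_ex trow)[i hi]; pose j := (s^-1)%g i.
  have gj := gs j; rewrite permKV in gj.
  have /orbitEP[k ->] := orbitE_trans hi (orbitE_sym gj).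
  by exists (iter k (@rotE a) (col j)); apply/rot_closureP; exists j, k.
- move=> u u' d /rot_closureP[j [k [-> ->]]] /rot_closureP[j' [k' [-> e]]].
  have jj : j = j'.
    apply: (transv_uniq tcol (orbitE_iter k _)).
    by rewrite e orbitE_iter.
  by rewrite -jj in e *; rewrite (iter_rot_inj (nc j) e).
- move=> u d d' /rot_closureP[j [k [-> ->]]] /rot_closureP[j' [k' [e ->]]].
  have jj : j = j'.
    apply: (@perm_inj _ s).
    apply: (transv_uniq trow (orbitE_trans (orbitE_iter k _) (gs j))).
    by rewrite e; apply: orbitE_trans (orbitE_iter k' _) (gs j').
  by rewrite -jj in e *; rewrite (iter_rot_inj (ng j) e).
- move=> u d /rot_closureP[j [k [-> ->]]]; apply/rot_closureP; exists j.
  have [k' kk'] : exists k' : 'I_3, forall t : expo a,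
      iter k' (@rotE a) t = iter k.+1 (@rotE a) t.
    case: k => [[|[|[|k]]] lt] //.
    + by exists (@Ordinal 3 1 isT).
    + by exists (@Ordinal 3 2 isT).
    + by exists ord0 => t /=; rewrite rot3.
  by exists k'; rewrite !kk'.
Qed.

Definition cspp_choice (p : {ffun 'I_a * 'I_a -> 'I_a.+1}) : {ffun 'I_n -> expo a} :=
  [ffun j => pull (surface a (cells p)) (col j)].

Local Notation cspps := [set p : {ffun 'I_a * 'I_a -> 'I_a.+1} | is_pp p && is_cs p].

Lemma cspp_choice_inj : {in cspps &, injective cspp_choice}.
Proof.
move=> p q; rewrite !inE => /andP[pp cp] /andP[pq cq] e.
have hp := height_of_cspp pp cp; have hq := height_of_cspp pq cq.
apply: surface_cells_inj => //; apply: pull_height_inj => // d dd.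
have [j /orbitEP[k ->]] := transv_ex tcol dd.
rewrite !pull_iter_rot ?(transv_deg tcol) //; congr (iter _ _ _).
by have := congr1 (fun g : {ffun _} => g j) e; rewrite !ffunE.
Qed.

Lemma cspp_choice_covers p : p \in cspps -> forall j, covers (cspp_choice p j) (col j).
Proof.
rewrite !inE => /andP[pp cp] j; rewrite ffunE.
by apply: pull_covers (height_of_cspp pp cp) _ _ _; rewrite ?(transv_deg tcol).
Qed.

Lemma cspp_choice_surj (g : {ffun 'I_n -> expo a}) (s : {perm 'I_n}) :
  (forall j, covers (g j) (col j)) -> (forall j, g j \in orbitE (row (s j))) ->
  g \in cspp_choice @: cspps.
Proof.
move=> cov gs; have mg := rot_closure_matching cov gs.
have [p [pp cp e]] := cspp_of_height (matching_heightP a0 mg).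
apply/imsetP; exists p; rewrite ?inE ?pp //; apply/ffunP => j; rewrite ffunE.
rewrite (pull_ext e) ?(transv_deg tcol) //; apply/esym; apply: matching_pull => //.
by apply/rot_closureP; exists j, ord0.
Qed.

Local Open Scope ring_scope.

Lemma det_cyclic_matchings : exists b : bool,
  \det (\matrix_(i, j) \sum_s ((s \in orbitE (row i)) && covers s (col j))%:R : 'M[int]_n)
  = (-1) ^+ b * (ncspp a)%:Z.
Proof.
have [s0 h0] := pull_perm_ex empty_heightP; exists (odd_perm s0).
rewrite (det_sum_choice _ (fun i s => s \in orbitE (row i)) (fun s j => covers s (col j))).
pose D (g : 'I_n -> expo a) : int := \det (\matrix_(i, j) (g j \in orbitE (row i))%:R).
transitivity (\sum_(g in cspp_choice @: cspps) D g).
  rewrite big_mkcond [RHS]big_mkcond; apply: eq_bigr => g _.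
  case: ifPn => [/forallP cg | ncg]; case: ifPn => // ig.
    (* A choice with nonzero determinant closes up to a matching, hence comes from a plane
       partition; all other choices contribute 0. *)
    apply/eqP; apply: contraNT ig => nz.
    have [s gs] := det_choice_neq0 (Q := fun i t => t \in orbitE (row i)) nz.
    exact: cspp_choice_surj gs.
  case/imsetP: ig ncg => p hp -> /forallPn[j] /negP[].
  exact: cspp_choice_covers.
rewrite (big_imset _ cspp_choice_inj) /=.
rewrite (eq_bigr (fun=> (-1) ^+ odd_perm s0)).
  by rewrite sumr_const /ncspp -mulr_natr natz.
move=> p; rewrite inE => /andP[pp cp].
have hp := height_of_cspp pp cp; have [s sp] := pull_perm_ex hp.
rewrite -(pull_perm_sign hp sp h0).
apply: (det_perm_choice _ (Q := fun i t => t \in orbitE (row i))).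
  by move=> j; rewrite ffunE.
exact: transv_uniq trow.
Qed.

End Quotient.

Lemma bvec_transversal a m : transversal_of m (@bvec a m).
Proof.
split; [exact: bvec_deg | exact: bvec_ex | exact: bvec_uniq].
Qed.

Local Open Scope ring_scope.

Theorem theorem3 (a : nat) (ha : (0 < a)%N) :
  exists e : #|basisC3 a (3 * a - 2)| = #|basisC3 a (3 * a - 2).+1|,
    \det (castmx (e, erefl) (Umat a (3 * a - 2))) = (ncspp a)%:Z \/
    \det (castmx (e, erefl) (Umat a (3 * a - 2))) = - (ncspp a)%:Z.
Proof.
have e := card_basisC3 ha; exists e.
have e1 : (3 * a - 2).+1 = (3 * a - 1)%N by lia.
have tcol : transversal_of (3 * a - 1) (@bvec a (3 * a - 2).+1).
  by rewrite -e1; apply: bvec_transversal.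
have trow : transversal_of (3 * a - 2) (fun i => @bvec a (3 * a - 2) (cast_ord (esym e) i)).
  have [h1 h2 h3] := @bvec_transversal a (3 * a - 2).
  split=> [i | t /h2[i hi] | i i' t hi hi']; first exact: h1.
    by exists (cast_ord e i); rewrite cast_ordK.
  by apply: (@cast_ord_inj _ _ (esym e)); apply: h3 hi hi'.
have [b hb] := det_cyclic_matchings ha trow tcol.
have -> : castmx (e, erefl) (Umat a (3 * a - 2)) =
    \matrix_(i, j) \sum_s ((s \in orbitE (bvec (cast_ord (esym e) i))) && covers s (bvec j))%:R.
  by apply/matrixP => i j; rewrite castmxE UmatE mxE cast_ord_id.
rewrite hb; case: b {hb} => /=; [right | left].
  by rewrite expr1 mulN1r.
by rewrite expr0 mul1r.
Qed.
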